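(* Let $(X,d)$ be an invariant metric group with group completion $(\overline{X},\overline{d})$. Then $$Is_m(Lip^1_+(X))\simeq Is_g(\overline{X}),$$ where $\simeq$ means isomorphic as groups, $Is_m(Lip^1_+(X))$ is the group (under composition) of all isometric automorphisms of the metric monoid $(Lip^1_+(X),\oplus,\rho)$, and $Is_g(\overline{X})$ is the group (under composition) of all isometric automorphisms of the metric group $(\overline{X},\overline{d})$.
   Context: A metric group is a group equipped with a metric. A metric group $(X,d)$ is called invariant if $d(xy,xz)=d(yx,zx)=d(y,z)$ for all $x,y,z\in X$. Its group completion $(\overline{X},\overline{d})$ is the metric completion of $(X,d)$ equipped with the unique continuous extension of the group operation; it is again an invariant metric group, containing $X$ as a dense subgroup. For a metric space $(X,d)$, $Lip^1_+(X)$ denotes the set of all nonnegative $1$-Lipschitz functions $f:X\to\mathbb{R}$, equipped with the metric $\rho(f,g)=\sup_{x\in X}\frac{|f(x)-g(x)|}{1+|f(x)-g(x)|}$. For a group $X$ and functions $f,g:X\to\mathbb{R}$, the inf-convolution is $(f\oplus g)(x)=\inf\{f(y)+g(z): y,z\in X,\ yz=x\}$. For an invariant metric group $(X,d)$ with identity $e$, $(Lip^1_+(X),\oplus)$ is a monoid whose identity element is $\delta_e:x\mapsto d(x,e)$. An isometric automorphism of a metric monoid (resp. metric group) is a bijective monoid (resp. group) homomorphism from it onto itself that preserves the metric. *)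

(* Defs.v *)
From HB Require Import structures.
From mathcomp Require Import all_boot all_order all_algebra.
From mathcomp Require Import all_classical all_reals topology.
From mathcomp Require Import ring lra.

Set Implicit Arguments.
Unset Strict Implicit.
Unset Printing Implicit Defensive.

Import Order.TTheory GRing.Theory Num.Theory.

Local Open Scope classical_set_scope.
Local Open Scope ring_scope.

(* No compatibility between the operation and the metric is assumed. *)
#[short(type="metricMonoidType")]
HB.structure Definition MetricMonoid (R : numDomainType) :=
  { M of Metric R M & Monoid M }.

#[short(type="metricGroupType")]
HB.structure Definition MetricGroup (R : numDomainType) :=
  { G of Metric R G & Group G }.

HB.mixin Record MetricGroup_isInvariant (R : numDomainType) G
    of MetricGroup R G := {
  mdist_mul2l : forall x y z : G,
    mdist (x * y)%g (x * z)%g = mdist y z ;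
  mdist_mul2r : forall x y z : G,
    mdist (y * x)%g (z * x)%g = mdist y z
}.

#[short(type="invMetricGroupType")]
HB.structure Definition InvMetricGroup (R : numDomainType) :=
  { G of MetricGroup R G & MetricGroup_isInvariant R G }.

#[short(type="completeMetricGroupType")]
HB.structure Definition CompleteMetricGroup (R : numDomainType) :=
  { G of MetricGroup R G & Complete G }.

(* [Xbar], seen through [iota], is a metric completion of [X] whose group
   operation is the continuous extension of that of [X]. Completeness is part
   of the type of [Xbar]; such an [Xbar] is determined by [X] up to a unique
   isometric isomorphism compatible with [iota], and its metric is
   automatically invariant. *)
Record is_group_completion (R : realType) (X : invMetricGroupType R)
    (Xbar : completeMetricGroupType R) (iota : X -> Xbar) : Prop := {
  completion_isometry : forall x y, mdist (iota x) (iota y) = mdist x y ;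
  completion_dense : dense (range iota) ;
  completion_extends : {morph iota : x y / (x * y)%g} ;
  completion_continuous : continuous (fun p : Xbar * Xbar => (p.1 * p.2)%g)
}.

Record lip1p (R : realType) (X : metricType R) := Lip1p {
  lip1p_fun :> X -> R ;
  lip1p_ge0 : forall x, 0 <= lip1p_fun x ;
  lip1p_lip : forall x y, `|lip1p_fun x - lip1p_fun y| <= mdist x y
}.

Section Lip1pMetric.
Variables (R : realType) (X : metricType R).
Implicit Types f g h : lip1p X.

Lemma lip1pP f g : f =1 g -> f = g.
Proof.
case: f g => [f f0 fl] [g g0 gl] /= /funext fg; rewrite -{}fg in g0 gl *.
by congr Lip1p; exact: Prop_irrelevance.
Qed.

HB.instance Definition _ := gen_eqMixin (lip1p X).
HB.instance Definition _ := gen_choiceMixin (lip1p X).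

(* The values are bounded by 1, so [sup] is a true supremum unless [X] is
   empty, in which case [sup set0 = 0] is the distance of the two equal
   functions. *)
Definition rho f g : R :=
  sup [set `|f x - g x| / (1 + `|f x - g x|) | x in [set: X]].

Lemma rho_sup f g x : `|f x - g x| / (1 + `|f x - g x|) <= rho f g.
Proof.
apply: ub_le_sup; last by exists x.
exists 1 => _ [y _ <-]; have := normr_ge0 (f y - g y).
by move=> t0; rewrite ler_pdivrMr ?mul1r; lra.
Qed.

Lemma rho_le f g r : 0 <= r ->
  (forall x, `|f x - g x| / (1 + `|f x - g x|) <= r) -> rho f g <= r.
Proof.
move=> r0 le_r; have [E|/set0P E] := eqVneq
  [set `|f x - g x| / (1 + `|f x - g x|) | x in [set: X]] set0.
  by rewrite /rho E sup0.
by apply: ge_sup => // _ [x _ <-].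
Qed.

Lemma rho_ge0 f g : 0 <= rho f g.
Proof.
rewrite /rho; have [->|/set0P[_ [x _ _]]] := eqVneq
  [set `|f x - g x| / (1 + `|f x - g x|) | x in [set: X]] set0.
  by rewrite sup0.
by apply: le_trans (rho_sup f g x); rewrite divr_ge0 ?addr_ge0.
Qed.

Lemma rhoxx f : rho f f = 0.
Proof.
apply/le_anti; rewrite rho_ge0 andbT; apply: rho_le => // x.
by rewrite subrr normr0 mul0r.
Qed.

Lemma rho_eq0 f g : rho f g = 0 -> f = g.
Proof.
move=> fg0; apply: lip1pP => x; have := rho_sup f g x; rewrite fg0.
have t0 := normr_ge0 (f x - g x); rewrite ler_pdivrMr ?mul0r; last by lra.
by move=> ?; apply/eqP; rewrite -subr_eq0 -normr_eq0; apply/eqP; lra.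
Qed.

Lemma rhoC f g : rho f g = rho g f.
Proof. by rewrite /rho; congr sup; apply: eq_imagel => x _; rewrite distrC. Qed.

Lemma rho_triangle g f h : rho f h <= rho f g + rho g h.
Proof.
apply: rho_le => [|x]; first by rewrite addr_ge0 ?rho_ge0.
apply: le_trans (lerD (rho_sup f g x) (rho_sup g h x)).
have := ler_distD (g x) (f x) (h x).
move: (normr_ge0 (f x - g x)) (normr_ge0 (g x - h x)) (normr_ge0 (f x - h x)).
move: `|f x - g x| `|g x - h x| `|f x - h x| => a b c a0 b0 c0 cab.
have ha : a / (1 + a + b) <= a / (1 + a).
  by rewrite ler_wpM2l// lef_pV2 ?posrE; lra.
have hb : b / (1 + a + b) <= b / (1 + b).
  by rewrite ler_wpM2l// lef_pV2 ?posrE; lra.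
apply: le_trans (lerD ha hb).
rewrite -mulrDl ler_pdivrMr; last by lra.
rewrite mulrAC ler_pdivlMr; last by lra.
by nra.
Qed.

HB.instance Definition _ :=
  isMetric.Build R (lip1p X) rhoxx rho_eq0 rhoC rho_triangle.

Lemma lip1p_mdistE f g : mdist f g = rho f g.
Proof. by []. Qed.

End Lip1pMetric.

(* [inf] is a true infimum when f and g are bounded below, hence on [lip1p X]. *)
Definition inf_conv (R : realType) (X : groupType) (f g : X -> R) (x : X) : R :=
  inf [set f p.1 + g p.2 | p in [set p : X * X | (p.1 * p.2)%g = x]].

Section Lip1pMonoid.
Variables (R : realType) (X : invMetricGroupType R).
Implicit Types f g h : lip1p X.

Lemma inf_conv_le f g y z : inf_conv f g (y * z)%g <= f y + g z.
Proof.
apply: ge_inf; last by exists (y, z).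
by exists 0 => _ [p _ <-]; rewrite addr_ge0 ?lip1p_ge0.
Qed.

Lemma inf_conv_ge f g x r :
  (forall y z, (y * z)%g = x -> r <= f y + g z) -> r <= inf_conv f g x.
Proof.
move=> le_r; apply: lb_le_inf => [|_ [p /= /le_r ? <-]//].
by exists (f x + g 1%g), (x, 1%g) => //=; rewrite mulg1.
Qed.

Lemma inf_conv_ge0 f g x : 0 <= inf_conv f g x.
Proof. by apply: inf_conv_ge => y z _; rewrite addr_ge0 ?lip1p_ge0. Qed.

Lemma inf_conv_lip f g x y :
  `|inf_conv f g x - inf_conv f g y| <= mdist x y.
Proof.
suff le_d u v : inf_conv f g u <= inf_conv f g v + mdist u v.
  rewrite ler_norml; have := le_d x y; have := le_d y x.
  by rewrite (metric_sym y x) => ? ?; apply/andP; split; lra.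
rewrite -lerBlDr; apply: inf_conv_ge => a b <-.
have := inf_conv_le f g a (a^-1 * u)%g; rewrite mulVKg => le1.
have := lip1p_lip g (a^-1 * u)%g b.
rewrite -(mdist_mul2l a) mulVKg ler_norml => /andP[_ le2].
by lra.
Qed.

Definition lip1p_mul f g : lip1p X :=
  Lip1p (inf_conv_ge0 f g) (inf_conv_lip f g).

Lemma delta_lip (x y : X) : `|mdist x 1%g - mdist y 1%g| <= mdist x y.
Proof.
have := metric_triangle x y 1%g; have := metric_triangle y x 1%g.
by rewrite (metric_sym y x) ler_norml => ? ?; apply/andP; split; lra.
Qed.

Definition lip1p_one : lip1p X :=
  Lip1p (fun x : X => mdist_ge0 x 1%g) delta_lip.

Lemma lip1p_mulA : associative lip1p_mul.
Proof.
move=> f g h; apply: lip1pP => x; apply/le_anti/andP; split.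
  apply: inf_conv_ge => y z <-; rewrite -lerBlDr; apply: inf_conv_ge => a b <-.
  have := inf_conv_le f (lip1p_mul g h) a (b * z)%g.
  have := inf_conv_le g h b z; rewrite mulgA /= => ? ?; lra.
apply: inf_conv_ge => y z <-; rewrite addrC -lerBlDr.
apply: inf_conv_ge => a b <-.
have := inf_conv_le (lip1p_mul f g) h (y * a)%g b.
have := inf_conv_le f g y a; rewrite mulgA /= => ? ?; lra.
Qed.

Lemma lip1p_mul1 : left_id lip1p_one lip1p_mul.
Proof.
move=> f; apply: lip1pP => x; apply/le_anti/andP; split.
  by have := inf_conv_le lip1p_one f 1%g x; rewrite mul1g /= mdistxx add0r.
apply: inf_conv_ge => y z <- /=.
have := lip1p_lip f (y * z)%g z.
have -> : mdist (y * z)%g z = mdist y 1%g by rewrite -[RHS](mdist_mul2r z) mul1g.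
rewrite ler_norml => /andP[_ ?]; lra.
Qed.

Lemma lip1p_mulr1 : right_id lip1p_one lip1p_mul.
Proof.
move=> f; apply: lip1pP => x; apply/le_anti/andP; split.
  by have := inf_conv_le f lip1p_one x 1%g; rewrite mulg1 /= mdistxx addr0.
apply: inf_conv_ge => y z <- /=.
have := lip1p_lip f (y * z)%g y.
have -> : mdist (y * z)%g y = mdist z 1%g by rewrite -[RHS](mdist_mul2l y) mulg1.
rewrite ler_norml => /andP[_ ?]; lra.
Qed.

HB.instance Definition _ :=
  isMonoid.Build (lip1p X) lip1p_mulA lip1p_mul1 lip1p_mulr1.

Lemma lip1p_mulE f g x : (f * g)%g x = inf_conv f g x.
Proof. by []. Qed.

Lemma lip1p_oneE x : (1%g : lip1p X) x = mdist x 1%g.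
Proof. by []. Qed.

End Lip1pMonoid.

(* For a metric group this is the type of isometric group automorphisms, since
   preservation of the unit then follows from multiplicativity. *)
Record isoAut (R : realType) (M : metricMonoidType R) := IsoAut {
  isoAut_fun :> M -> M ;
  isoAut_bij : bijective isoAut_fun ;
  isoAut_morph : monoid.monoid_morphism isoAut_fun ;
  isoAut_isom : forall x y,
    mdist (isoAut_fun x) (isoAut_fun y) = mdist x y
}.

Section IsoAutGroup.
Variables (R : realType) (M : metricMonoidType R).
Implicit Types a b c : isoAut M.

Lemma isoAutP a b : a =1 b -> a = b.
Proof.
case: a b => [f fb fm fi] [g gb gm gi] /= /funext fg; rewrite -{}fg in gb gm gi *.
by congr IsoAut; exact: Prop_irrelevance.
Qed.

HB.instance Definition _ := gen_eqMixin (isoAut M).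
HB.instance Definition _ := gen_choiceMixin (isoAut M).

Definition isoAut_one : isoAut M :=
  @IsoAut R M id (Bijective (fun=> erefl) (fun=> erefl))
    (erefl, fun _ _ => erefl) (fun _ _ => erefl).

Lemma isoAut_comp_morph a b : monoid.monoid_morphism (a \o b).
Proof.
by split=> [|x y] /=; rewrite !(isoAut_morph a, isoAut_morph b).
Qed.

Lemma isoAut_comp_isom a b x y : mdist ((a \o b) x) ((a \o b) y) = mdist x y.
Proof. by rewrite /= !isoAut_isom. Qed.

Definition isoAut_mul a b : isoAut M :=
  IsoAut (bij_comp (isoAut_bij a) (isoAut_bij b)) (isoAut_comp_morph a b)
    (isoAut_comp_isom a b).

Lemma isoAut_has_inv a : exists b, cancel a b /\ cancel b a.
Proof.
have [g ag ga] := isoAut_bij a.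
have gm : monoid.monoid_morphism g.
  split=> [|x y]; apply: (can_inj ag); rewrite ga (isoAut_morph a) //.
  by rewrite !ga.
have gi x y : mdist (g x) (g y) = mdist x y by rewrite -(isoAut_isom a) !ga.
by exists (IsoAut (Bijective ga ag) gm gi).
Qed.

Definition isoAut_inv a : isoAut M := projT1 (cid (isoAut_has_inv a)).

Lemma isoAut_mulA : associative isoAut_mul.
Proof. by move=> a b c; apply: isoAutP. Qed.

Lemma isoAut_mul1 : left_id isoAut_one isoAut_mul.
Proof. by move=> a; apply: isoAutP. Qed.

Lemma isoAut_mulr1 : right_id isoAut_one isoAut_mul.
Proof. by move=> a; apply: isoAutP. Qed.

Lemma isoAut_mulV : left_inverse isoAut_one isoAut_inv isoAut_mul.
Proof.
by move=> a; apply: isoAutP => x /=; rewrite /isoAut_inv; case: cid => b [/= ->].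
Qed.

Lemma isoAut_mulrV : right_inverse isoAut_one isoAut_inv isoAut_mul.
Proof.
by move=> a; apply: isoAutP => x /=; rewrite /isoAut_inv; case: cid => b [/= _ ->].
Qed.

HB.instance Definition _ :=
  isGroup.Build (isoAut M) isoAut_mulA isoAut_mul1 isoAut_mulr1
    isoAut_mulV isoAut_mulrV.

Lemma isoAut_mulE a b x : (a * b)%g x = a (b x).
Proof. by []. Qed.

End IsoAutGroup.

(* The library's [isog] only covers finite groups. *)
Definition group_isomorphic (G H : groupType) : Prop :=
  exists2 phi : G -> H, bijective phi & {morph phi : x y / (x * y)%g}.

(* Main.v *)
Require Import Defs.
From mathcomp Require Import all_boot all_order all_algebra.
From mathcomp Require Import all_classical all_reals topology.
From mathcomp Require Import ring lra.

(** The invertible elements of [lip1p X] are exactly the functions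
    [x |-> d (iota x) a] with [a] in [Xbar]: if [f * g = 1], the points [y] where
    [f y + g y^-1] is small form a Cauchy filter, and [a] is its limit. So an
    isometric automorphism of [lip1p X] restricts to one of [Xbar], and every
    automorphism [T] of [Xbar] arises in this way, from
    [f |-> (x |-> inf_y (f y + d (T (iota y)) (iota x)))].

    It remains to see that an automorphism fixing all the distance functions is
    the identity. It commutes with translations, hence preserves and then fixes
    the constants; so it preserves the bounds of a function and its oscillation,
    and therefore fixes [m_c := min (d _ 1) c], the unit of the monoid of
    functions of oscillation at most [c]. If [c <= f <= 2 c], then [f a] is the
    sup-distance from [f] to the translate of [m_c] at [a], so [f] is fixed. As
    [f + c = f * (m_c + c)] when [f <= c], bounded functions are fixed; and an
    arbitrary [f] is recovered from the bounded functions
    [f * m_c = min f (inf f + c)]. *)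

Set Implicit Arguments.
Unset Strict Implicit.
Unset Printing Implicit Defensive.

Import Order.TTheory GRing.Theory Num.Theory.

Local Open Scope classical_set_scope.
Local Open Scope ring_scope.

(** * The metric [rho] and the sup-distance; basic 1-Lipschitz functions *)

Section SupDistance.
Variables (R : realType) (X : metricType R).
Implicit Types f g : lip1p X.

Lemma lip1p_le f x y : f x <= f y + mdist x y.
Proof. by have := lip1p_lip f x y; rewrite ler_norml => /andP[_ ?]; lra. Qed.

Lemma ler_frac1D (s t : R) : 0 <= s -> 0 <= t ->
  (s / (1 + s) <= t / (1 + t)) = (s <= t).
Proof.
move=> s0 t0; rewrite ler_pdivrMr; last by lra.
rewrite mulrAC ler_pdivlMr; last by lra.
by rewrite !mulrDr !mulr1 [t * s]mulrC lerD2r.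
Qed.

(** As [t / (1 + t)] is increasing, [rho]-balls of radius below 1 are exactly the sup-distance balls
    of finite radius, even though the sup-distance itself may be infinite. *)
Lemma mdist_lip1pP f g (r : R) : 0 <= r ->
  mdist f g <= r / (1 + r) <-> forall x, `|f x - g x| <= r.
Proof.
move=> r0; rewrite lip1p_mdistE; split=> [fg x|fg].
  by rewrite -ler_frac1D//; exact: le_trans (rho_sup f g x) fg.
by apply: rho_le => [|x]; rewrite ?ler_frac1D// divr_ge0// addr_ge0.
Qed.

(** A distance below 1 has the form [r / (1 + r)], and there the hypothesis applies; otherwise the
    bound is trivial, since [rho] never exceeds 1. *)
Lemma mdist_lip1p_le (f g f' g' : lip1p X) :
  (forall r : R, 0 <= r -> (forall x, `|f x - g x| <= r) ->
     forall x, `|f' x - g' x| <= r) ->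
  mdist f' g' <= mdist f g.
Proof.
move=> le_r; have [fg1|fg1] := ltP (mdist f g) 1; last first.
  apply: le_trans fg1; rewrite lip1p_mdistE; apply: rho_le => // x.
  by have := normr_ge0 (f' x - g' x) => t0; rewrite ler_pdivrMr ?mul1r; lra.
have fg0 : 0 <= mdist f g by exact: mdist_ge0.
pose r := mdist f g / (1 - mdist f g).
have r0 : 0 <= r by rewrite divr_ge0// subr_ge0 ltW.
have rE : r / (1 + r) = mdist f g by rewrite /r; field; apply/andP; split; lra.
rewrite -rE; apply/(mdist_lip1pP _ _ r0)/le_r => //.
by apply/mdist_lip1pP; rewrite ?rE.
Qed.

Lemma dist_fun_lip (a x y : X) : `|mdist x a - mdist y a| <= mdist x y.
Proof.
have := metric_triangle x y a; have := metric_triangle y x a.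
by rewrite (metric_sym y x) ler_norml => ? ?; apply/andP; split; lra.
Qed.

Definition dist_fun (a : X) : lip1p X :=
  Lip1p (fun x => mdist_ge0 x a) (dist_fun_lip a).

Lemma cst_fun_lip (c : R) (x y : X) : `|c - c| <= mdist x y.
Proof. by rewrite subrr normr0 mdist_ge0. Qed.

Definition cst_fun (c : R) (c0 : 0 <= c) : lip1p X :=
  Lip1p (fun=> c0) (cst_fun_lip c).

Lemma cap_fun_ge0 f (c : R) : 0 <= c -> forall x, 0 <= Num.min (f x) c.
Proof. by move=> c0 x; rewrite le_min lip1p_ge0. Qed.

Lemma cap_fun_lip f (c : R) x y :
  `|Num.min (f x) c - Num.min (f y) c| <= mdist x y.
Proof.
have := lip1p_le f x y; have := lip1p_le f y x; have := mdist_ge0 x y.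
rewrite (metric_sym y x) ler_norml => ? ? ?; apply/andP; split; rewrite /Num.min;
  by case: ltP => ?; case: ltP => ?; lra.
Qed.

Definition cap_fun f (c : R) (c0 : 0 <= c) : lip1p X :=
  Lip1p (cap_fun_ge0 f c0) (cap_fun_lip f c).

Lemma add_fun_ge0 f (c : R) : 0 <= c -> forall x, 0 <= f x + c.
Proof. by move=> c0 x; rewrite addr_ge0// lip1p_ge0. Qed.

Lemma add_fun_lip f (c : R) x y : `|(f x + c) - (f y + c)| <= mdist x y.
Proof. by rewrite opprD addrACA subrr addr0 lip1p_lip. Qed.

Definition add_fun f (c : R) (c0 : 0 <= c) : lip1p X :=
  Lip1p (add_fun_ge0 f c0) (add_fun_lip f c).

End SupDistance.

(** * Inf-convolution with distances, constants and truncated distances *)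

Section Convolution.
Variables (R : realType) (X : invMetricGroupType R).
Implicit Types (f g : lip1p X) (a x : X) (c r : R).

Lemma lip1p_mul_eq f g x r :
  (forall y z, (y * z)%g = x -> r <= f y + g z) ->
  (exists y, f y + g (y^-1 * x)%g <= r) ->
  (f * g)%g x = r.
Proof.
move=> ge_r [y le_r]; apply/le_anti/andP; split.
  by apply: le_trans le_r; rewrite -[x in X in X <= _](mulVKg y) inf_conv_le.
exact: inf_conv_ge.
Qed.

(** The Lipschitz bound makes the splitting with first factor [a] optimal, so these products encode
    left translations inside the monoid. *)
Lemma dist_fun_mul a f x : (dist_fun a * f)%g x = f (a^-1 * x)%g.
Proof.
apply: lip1p_mul_eq => [y z <-|]; last first.
  by exists a; rewrite //= mdistxx add0r.
rewrite /= addrC (le_trans (lip1p_le _ _ z))// lerD2l.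
by rewrite -(mdist_mul2l a) mulVKg mdist_mul2r.
Qed.

Lemma cst_fun_mul c c' (c0 : 0 <= c) (c0' : 0 <= c') :
  (cst_fun X c0 * cst_fun X c0')%g = cst_fun X (addr_ge0 c0 c0').
Proof. by apply: lip1pP => x; apply: lip1p_mul_eq => //; exists 1%g. Qed.

Lemma dist_fun_mul_cst a c (c0 : 0 <= c) :
  (dist_fun a * cst_fun X c0)%g = cst_fun X c0.
Proof. by apply: lip1pP => x; rewrite dist_fun_mul. Qed.

Lemma translation_invariant_cst f :
  (forall a, (dist_fun a * f)%g = f) -> f = cst_fun X (lip1p_ge0 f 1%g).
Proof.
move=> finv; apply: lip1pP => x /=.
by rewrite -[in LHS](finv x) dist_fun_mul mulVg.
Qed.

(** The splitting [x * 1] attains [f x]. In any other splitting the cap contributes either a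
    distance, handled by the Lipschitz property, or [c], handled by the oscillation bound. *)
Lemma mul_cap f c (c0 : 0 <= c) :
  (forall x y, f x <= f y + c) -> (f * cap_fun 1%g c0)%g = f.
Proof.
move=> osc; apply: lip1pP => x; apply: lip1p_mul_eq => [y z <-|]; last first.
  by exists x; rewrite //= mulVg mdistxx min_l// addr0.
rewrite /= /Num.min; case: ltP => _; last exact: osc.
rewrite (le_trans (lip1p_le f _ y))// lerD2l.
by rewrite -[X in mdist _ X]mulg1 mdist_mul2l.
Qed.

Lemma cap_mul f c (c0 : 0 <= c) :
  (forall x y, f x <= f y + c) -> (cap_fun 1%g c0 * f)%g = f.
Proof.
move=> osc; apply: lip1pP => x; apply: lip1p_mul_eq => [y z <-|]; last first.
  by exists 1%g; rewrite //= mdistxx min_l// add0r invg1 mul1g.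
rewrite /= addrC /Num.min; case: ltP => _; last exact: osc.
rewrite (le_trans (lip1p_le f _ z))// lerD2l.
by rewrite -[X in mdist _ X]mul1g mdist_mul2r.
Qed.

Lemma mul_cap_le f c (c0 : 0 <= c) x y : (f * cap_fun 1%g c0)%g x <= f y + c.
Proof.
rewrite -[x](mulVKg y); apply: le_trans (inf_conv_le _ _ _ _) _.
by rewrite lerD2l /= ge_min lexx orbT.
Qed.

Lemma mul_capE f c (c0 : 0 <= c) x : f x <= c ->
  (f * cap_fun 1%g c0)%g x = f x.
Proof.
move=> fxc; apply: lip1p_mul_eq => [y z xE|]; last first.
  by exists x; rewrite //= mulVg mdistxx min_l// addr0.
rewrite /= /Num.min; case: ltP => _; last first.
  by apply: le_trans fxc _; rewrite lerDr lip1p_ge0.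
rewrite (le_trans (lip1p_le f _ y))// lerD2l -xE.
by rewrite -[X in mdist _ X]mulg1 mdist_mul2l.
Qed.

Lemma mul_add f g c (c0 : 0 <= c) : (f * add_fun g c0)%g = add_fun (f * g)%g c0.
Proof.
apply: lip1pP => x; apply/le_anti/andP; split.
  rewrite /= -lerBlDr; apply: inf_conv_ge => y z <-.
  by have /= := inf_conv_le f (add_fun g c0) y z; lra.
apply: inf_conv_ge => y z <- /=; have := inf_conv_le f g y z; lra.
Qed.

End Convolution.

(** * Automorphisms fixing the distance functions are trivial *)

Section Rigidity.
Variables (R : realType) (X : invMetricGroupType R).
Implicit Types (f g : lip1p X) (a x : X) (c r : R) (Phi : isoAut (lip1p X)).

Definition fixes_dist Phi := forall a, Phi (dist_fun a) = dist_fun a.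

Lemma isoAutK Phi : cancel Phi (Phi^-1)%g.
Proof. by move=> f; rewrite -isoAut_mulE mulVg. Qed.

Lemma isoAutVK Phi : cancel (Phi^-1)%g Phi.
Proof. by move=> f; rewrite -isoAut_mulE mulgV. Qed.

Lemma fixes_distV Phi : fixes_dist Phi -> fixes_dist (Phi^-1)%g.
Proof. by move=> fixPhi a; rewrite -[in LHS](fixPhi a) isoAutK. Qed.

Lemma isoAut_near Phi f g r : 0 <= r ->
  (forall x, `|f x - g x| <= r) -> forall x, `|Phi f x - Phi g x| <= r.
Proof.
by move=> r0 /(mdist_lip1pP _ _ r0); rewrite -(isoAut_isom Phi) mdist_lip1pP.
Qed.

Lemma isoAut_cst_cst Phi c (c0 : 0 <= c) : fixes_dist Phi ->
  Phi (cst_fun X c0) = cst_fun X (lip1p_ge0 (Phi (cst_fun X c0)) 1%g).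
Proof.
move=> fixPhi; apply: translation_invariant_cst => a.
by rewrite -{1}(fixPhi a) -(isoAut_morph Phi) dist_fun_mul_cst.
Qed.

Lemma isoAut_cst_le Phi c (c0 : 0 <= c) x : fixes_dist Phi ->
  Phi (cst_fun X c0) x <= c.
Proof.
move=> fixPhi.
(* The image of the zero function is a constant [k] with [k = k + k], hence zero; the sup-distance
   to it then bounds the image of [c]. *)
have zero_idem : (cst_fun X (lexx 0) * cst_fun X (lexx 0))%g =
    cst_fun X (lexx 0) :> lip1p X.
  by rewrite cst_fun_mul; apply: lip1pP => y /=; rewrite addr0.
have zeroE : Phi (cst_fun X (lexx 0)) x = 0.
  have := congr1 (fun f => Phi f x) zero_idem.
  rewrite (isoAut_morph Phi) (isoAut_cst_cst _ fixPhi) cst_fun_mul /=.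
  by lra.
have cst_near y : `|cst_fun X c0 y - cst_fun X (lexx 0) y| <= c.
  by rewrite /= subr0 ger0_norm.
have := isoAut_near Phi c0 cst_near x.
by rewrite zeroE subr0 ger0_norm// lip1p_ge0.
Qed.

Lemma isoAut_cst Phi c (c0 : 0 <= c) : fixes_dist Phi ->
  Phi (cst_fun X c0) = cst_fun X c0.
Proof.
move=> fixPhi; apply: lip1pP => x; apply/le_anti/andP; split.
  exact: isoAut_cst_le.
(* The reverse inequality is the same bound for the inverse automorphism, applied to the constant
   [Phi (cst_fun X c0)]. *)
have := isoAut_cst_le (lip1p_ge0 (Phi (cst_fun X c0)) 1%g) x (fixes_distV fixPhi).
by rewrite -isoAut_cst_cst// isoAutK {2}isoAut_cst_cst.
Qed.

Lemma isoAut_near_cst Phi f c (c0 : 0 <= c) r : fixes_dist Phi -> 0 <= r ->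
  (forall x, `|f x - c| <= r) -> forall x, `|Phi f x - c| <= r.
Proof.
move=> fixPhi r0 fc x.
have := @isoAut_near Phi f (cst_fun X c0) r r0 fc x.
by rewrite isoAut_cst.
Qed.

(** Values in [[p, q]] mean sup-distance at most [(q - p) / 2] from the midpoint constant, which is
    fixed. *)
Lemma isoAut_itv Phi f (p q : R) : fixes_dist Phi -> 0 <= p + q ->
  (forall x, p <= f x <= q) -> forall x, p <= Phi f x <= q.
Proof.
move=> fixPhi pq0 fpq x.
have c0 : 0 <= (p + q) / 2 by lra.
have r0 : 0 <= (q - p) / 2 by have := fpq 1%g; lra.
have near y : `|f y - (p + q) / 2| <= (q - p) / 2.
  by rewrite ler_norml; have := fpq y; lra.
by have := isoAut_near_cst c0 fixPhi r0 near x; rewrite ler_norml; lra.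
Qed.

(* [cap_fun 1 c] is the unit of the monoid of functions of oscillation at most
   [c], and lies in it. *)
Lemma isoAut_cap Phi c (c0 : 0 <= c) : fixes_dist Phi ->
  Phi (cap_fun 1%g c0) = cap_fun 1%g c0.
Proof.
move=> fixPhi; set m := cap_fun _ _.
have m_osc x : 0 <= m x <= c by rewrite lip1p_ge0 /= ge_min lexx orbT.
have osc (Psi : isoAut (lip1p X)) : fixes_dist Psi ->
    forall x y, Psi m x <= Psi m y + c.
  move=> fixPsi x y.
  have := @isoAut_itv Psi m 0 c fixPsi _ m_osc; rewrite add0r => /(_ c0) itv.
  by have := itv x; have := itv y; lra.
rewrite -[LHS](mul_cap c0 (osc _ fixPhi)) -/m -[X in (_ * X)%g](isoAutVK Phi).
rewrite -(isoAut_morph Phi) cap_mul ?isoAutVK//.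
exact/osc/fixes_distV.
Qed.

Lemma isoAut_high_le Phi f c (c0 : 0 <= c) a : fixes_dist Phi ->
  (forall x, c <= f x <= c + c) -> Phi f a <= f a.
Proof.
move=> fixPhi fc; pose m := (dist_fun a * cap_fun 1%g c0)%g.
have mE x : m x = Num.min (mdist x a) c.
  by rewrite /m dist_fun_mul /= -(mdist_mul2l a) mulVKg mulg1.
have Phim : Phi m = m by rewrite (isoAut_morph Phi) fixPhi isoAut_cap.
(* Here [m <= c <= f]. Where [m] is the distance to [a], the Lipschitz property gives the bound;
   where [m] is [c], it reads [f x - c <= c <= f a]. As [m a = 0], evaluating the image bound at [a]
   isolates [Phi f a]. *)
have fm x : `|f x - m x| <= f a.
  have := lip1p_le f x a; have := fc x; have := fc a; have := mdist_ge0 x a.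
  by rewrite mE /Num.min ler_norml; case: ltP => ? ? ? ? ?; lra.
have := isoAut_near Phi (lip1p_ge0 f a) fm a.
rewrite Phim mE mdistxx min_l// subr0 ger0_norm//; exact: lip1p_ge0.
Qed.

Lemma isoAut_high Phi f c (c0 : 0 <= c) : fixes_dist Phi ->
  (forall x, c <= f x <= c + c) -> Phi f = f.
Proof.
move=> fixPhi fc; apply: lip1pP => x; apply/le_anti.
(* [Phi f] has the same bounds as [f], so the inequality also applies to it with the inverse
   automorphism. *)
rewrite (isoAut_high_le c0)//= -{1}[f](isoAutK Phi).
apply: (isoAut_high_le c0); first exact: fixes_distV.
by apply: isoAut_itv => //; lra.
Qed.

Lemma isoAut_low Phi f c (c0 : 0 <= c) : fixes_dist Phi ->
  (forall x, f x <= c) -> Phi f = f.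
Proof.
move=> fixPhi fc; set m := cap_fun (1%g : lip1p X) c0.
have fE : (f * add_fun m c0)%g = add_fun f c0.
  rewrite mul_add mul_cap// => x y.
  by have := fc x; have := lip1p_ge0 f y; lra.
have m_osc x : 0 <= m x <= c by rewrite lip1p_ge0 /= ge_min lexx orbT.
have := congr1 Phi fE; rewrite (isoAut_morph Phi).
(* Both [f + c] and [m + c] take values in [[c, 2c]], hence are fixed; this leaves
   [Phi f * (m + c) = f + c], whose left side is [Phi f + c]. *)
rewrite !(@isoAut_high _ (add_fun _ c0) c)//; last 2 first.
- by move=> x /=; have := fc x; have := lip1p_ge0 f x; lra.
- by move=> x; have := m_osc x; rewrite /add_fun; cbn [lip1p_fun]; lra.
rewrite mul_add mul_cap => [E|x y]; last first.
  have f0c z : 0 <= f z <= c by rewrite lip1p_ge0 fc.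
  have := @isoAut_itv Phi f 0 c fixPhi _ f0c; rewrite add0r => /(_ c0) itv.
  by have := itv x; have := itv y; lra.
apply: lip1pP => x; have := congr1 (fun h : lip1p X => h x) E => /=.
exact: addIr.
Qed.

Lemma isoAut_rigid Phi : fixes_dist Phi -> Phi = 1%g.
Proof.
move=> fixPhi; apply: isoAutP => f; apply: lip1pP => x /=.
(* This level dominates both [f x] and [Phi f x], so multiplying by the cap changes neither value at
   [x]. *)
have c0 : 0 <= f x + Phi f x by rewrite addr_ge0 ?lip1p_ge0.
rewrite -(@mul_capE _ _ (Phi f) _ c0); last by rewrite lerDr lip1p_ge0.
rewrite -[RHS](@mul_capE _ _ f _ c0); last by rewrite lerDl lip1p_ge0.
rewrite -[in LHS](isoAut_cap c0 fixPhi) -(isoAut_morph Phi).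
have d0 : 0 <= f x + (f x + Phi f x) by rewrite addr_ge0// lip1p_ge0.
by rewrite (@isoAut_low _ _ _ d0) => // y; exact: mul_cap_le.
Qed.

End Rigidity.

(** * Invariance of the completed metric; distance functions to points of [Xbar] *)

Section Completion.
Variables (R : realType) (X : invMetricGroupType R).
Variables (Xbar : completeMetricGroupType R) (iota : X -> Xbar).
Hypothesis iotaP : is_group_completion iota.
Implicit Types (f g : lip1p X) (x y z : X) (a b c : Xbar) (e r : R).

Lemma completion_approx a e : 0 < e -> exists x, mdist (iota x) a < e.
Proof.
move=> e0; have nbhs_ball : nbhs a (ball a e) by exact: nbhsx_ballx.
have ne : (ball a e)^° !=set0 by exists a; exact: nbhs_ball.
have [b [/interior_subset ab [x _ xE]]] :=
  completion_dense iotaP ne (@open_interior _ (ball a e)).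
by exists x; move: ab; rewrite -xE ballEmdist /= metric_sym.
Qed.

Lemma completion_mul_near a b e : 0 < e -> exists2 d, 0 < d &
  forall u v, mdist u a < d -> mdist v b < d -> mdist (u * v)%g (a * b)%g < e.
Proof.
move=> e0; have /cvg_ballP/(_ e e0)/nbhs_ballP[d /= d0 ball_mul] :=
  @completion_continuous _ _ _ _ iotaP (a, b).
exists d => // u v ua vb; have := ball_mul (u, v).
rewrite ballEmdist /= metric_sym; apply.
by split; rewrite /= ballEmdist /= metric_sym.
Qed.

Lemma iota1 : iota 1%g = 1%g.
Proof.
by apply: (mulgI (iota 1%g)); rewrite -(completion_extends iotaP) !mulg1.
Qed.

Lemma completion_mdist_mul a b c :
  mdist (a * b)%g (a * c)%g = mdist b c /\ mdist (b * a)%g (c * a)%g = mdist b c.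
Proof.
have approx e : 0 < e -> exists x y z,
    [/\ mdist (iota y) b < e, mdist (iota z) c < e,
      mdist (iota (x * y)%g) (a * b)%g < e /\ mdist (iota (x * z)%g) (a * c)%g < e &
      mdist (iota (y * x)%g) (b * a)%g < e /\ mdist (iota (z * x)%g) (c * a)%g < e].
  move=> e0; have [d1 d10 ab] := completion_mul_near a b e0.
  have [d2 d20 ac] := completion_mul_near a c e0.
  have [d3 d30 ba] := completion_mul_near b a e0.
  have [d4 d40 ca] := completion_mul_near c a e0.
  pose d := Num.min (Num.min d1 d2) (Num.min (Num.min d3 d4) e).
  have d0 : 0 < d by rewrite !lt_min d10 d20 d30 d40 e0.
  have [x] := completion_approx a d0; rewrite !lt_min.
  move=> /and3P[/andP[? ?] /andP[? ?] ?].
  have [y] := completion_approx b d0; rewrite !lt_min.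
  move=> /and3P[/andP[? ?] /andP[? ?] ?].
  have [z] := completion_approx c d0; rewrite !lt_min.
  move=> /and3P[/andP[? ?] /andP[? ?] ?].
  exists x, y, z; rewrite !(completion_extends iotaP).
  by split=> //; split; [exact: ab|exact: ac|exact: ba|exact: ca].
have quad (u v u' v' : Xbar) e : mdist u u' < e -> mdist v v' < e ->
    `|mdist u v - mdist u' v'| <= e + e.
  move=> uu' vv'.
  have := metric_triangle u u' v; have := metric_triangle u' v' v.
  have := metric_triangle u' u v'; have := metric_triangle u v v'.
  by rewrite ler_norml (metric_sym v' v) (metric_sym u' u); lra.
(* Invariance is exact on the approximating points of [X]; replacing each of the two distances costs
   at most [e / 2]. *)
split; apply/eqP; rewrite -subr_eq0 -normr_le0; apply/ler_addgt0Pr => e e0;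
  have [|x [y [z [yb zc [ab ac] [ba ca]]]]] := approx (e / 4); try lra.
- have := quad _ _ _ _ _ yb zc; have := quad _ _ _ _ _ ab ac.
  rewrite !(completion_isometry iotaP) mdist_mul2l !ler_norml; lra.
- have := quad _ _ _ _ _ yb zc; have := quad _ _ _ _ _ ba ca.
  rewrite !(completion_isometry iotaP) mdist_mul2r !ler_norml; lra.
Qed.

Lemma completion_mul2l a b c : mdist (a * b)%g (a * c)%g = mdist b c.
Proof. by case: (completion_mdist_mul a b c). Qed.

Lemma completion_mul2r a b c : mdist (b * a)%g (c * a)%g = mdist b c.
Proof. by case: (completion_mdist_mul a b c). Qed.

Lemma completion_dist_lip a x y :
  `|mdist (iota x) a - mdist (iota y) a| <= mdist x y.
Proof. by rewrite -(completion_isometry iotaP) dist_fun_lip. Qed.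

Definition completion_dist a : lip1p X :=
  Lip1p (fun x => mdist_ge0 (iota x) a) (completion_dist_lip a).

Lemma completion_dist_iota x : completion_dist (iota x) = dist_fun x.
Proof. by apply: lip1pP => y; rewrite /= (completion_isometry iotaP). Qed.

Lemma completion_dist1 : completion_dist 1%g = 1%g.
Proof. by rewrite -iota1 completion_dist_iota; apply: lip1pP. Qed.

Lemma completion_distM a b :
  completion_dist (a * b)%g = (completion_dist a * completion_dist b)%g.
Proof.
apply: lip1pP => x; apply/le_anti/andP; split.
  apply: inf_conv_ge => y z <- /=; rewrite (completion_extends iotaP).
  have := metric_triangle (iota y * iota z)%g (a * iota z)%g (a * b)%g.
  by rewrite completion_mul2l completion_mul2r.
apply/ler_addgt0Pr => e e0.
(* The ideal splitting starts with [a], which may lie outside [X]; a nearby [y] costs [e / 2] in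
   each of the two terms. *)
have [|y ya] := @completion_approx a (e / 2); first by rewrite divr_gt0.
have := inf_conv_le (completion_dist a) (completion_dist b) y (y^-1 * x)%g.
rewrite mulVKg /= -[mdist (iota (_ * _)%g) b](completion_mul2l (iota y)).
rewrite -(completion_extends iotaP) mulVKg.
have := metric_triangle (iota x) (a * b)%g (iota y * b)%g.
rewrite completion_mul2r (metric_sym a); lra.
Qed.

(** The difference of the two distance functions nearly reaches [mdist a b] at points of [X] close
    to [a]. Thus [Xbar] embeds isometrically for the sup-distance. *)
Lemma completion_dist_near a b r :
  (forall x, `|completion_dist a x - completion_dist b x| <= r) <-> mdist a b <= r.
Proof.
split=> [near|ab x /=]; last first.
  by rewrite (metric_sym _ a) (metric_sym _ b) (le_trans (dist_fun_lip _ _ _)).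
apply/ler_addgt0Pr => e e0.
have [|x xa] := @completion_approx a (e / 2); first by rewrite divr_gt0.
have := near x; rewrite /= ler_norml; have := metric_triangle a (iota x) b.
rewrite (metric_sym a (iota x)); lra.
Qed.

Lemma completion_dist_inj : injective completion_dist.
Proof.
move=> a b ab; apply/mdist_positivity/le_anti; rewrite mdist_ge0 andbT.
by apply/completion_dist_near => x; rewrite ab subrr normr0.
Qed.

(** * Invertible elements are distance functions *)

Lemma mul_eq1_infinitesimal f g e : (f * g)%g = 1%g -> 0 < e ->
  exists y, f y + g (y^-1)%g < e.
Proof.
move=> fg1 e0; apply: contrapT => /forallNP no_y.
have : e <= (f * g)%g 1%g.
  apply: inf_conv_ge => y z yz1; rewrite leNgt; apply/negP => lt_e.
  apply: (no_y y); suff -> : (y^-1)%g = z by [].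
  by apply: (mulgI y); rewrite mulgV yz1.
by rewrite fg1 lip1p_oneE mdistxx; lra.
Qed.

Lemma mul_eq1_le f g x y : (f * g)%g = 1%g -> mdist x y <= f x + g (y^-1)%g.
Proof.
move=> fg1; have := inf_conv_le f g x (y^-1)%g.
by rewrite -lip1p_mulE fg1 lip1p_oneE -[mdist x y](mdist_mul2r (y^-1)%g) mulgV.
Qed.

Lemma mul_eq1_cvg f g : (f * g)%g = 1%g -> exists a, forall e, 0 < e ->
  exists2 y, mdist (iota y) a < e & f y + g (y^-1)%g < e.
Proof.
move=> fg1; pose small e := [set iota y | y in [set y | f y + g (y^-1)%g < e]].
pose F := filter_from [set e : R | 0 < e] small.
have F_proper : ProperFilter F.
  apply: filter_from_proper.
    apply: filter_from_filter; first by exists 1; exact: ltr01.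
    move=> d e d0 e0; exists (Num.min d e); first by rewrite /= lt_min d0 e0.
    by move=> _ [y /= + <-]; rewrite lt_min => /andP[yd ye]; split; exists y.
  move=> e e0; have [y ye] := mul_eq1_infinitesimal fg1 e0.
  by exists (iota y); exists y.
(* If [f + g] of the inverse is below [e / 2] at both [x] and [y], then
   [mdist x y <= f x + g (y^-1) < e], all terms being nonnegative. *)
have F_cauchy : cauchy F.
  apply: cauchy_exP => e e0; have e20 : 0 < e / 2 by rewrite divr_gt0.
  have [x xe] := mul_eq1_infinitesimal fg1 e20.
  exists (iota x), (e / 2) => // _ [y ye <-].
  rewrite ballEmdist /= (completion_isometry iotaP).
  have := mul_eq1_le x y fg1; have := lip1p_ge0 g (x^-1)%g; have := lip1p_ge0 f y.
  by move: ye => /=; lra.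
have F_cvg : F --> lim F := @cauchy_cvg _ F F_proper F_cauchy.
exists (lim F) => e e0; have [d d0 F_ball] := F_cvg (ball (lim F) e) (nbhsx_ballx (lim F) e e0).
have [|y] := @mul_eq1_infinitesimal f g (Num.min d e) fg1.
  by rewrite lt_min d0 e0.
rewrite lt_min => /andP[yd ye]; exists y => //.
by have := F_ball (iota y); rewrite ballEmdist /= metric_sym; apply; exists y.
Qed.

(** Near the limit point [a], both [f y] and [g (y^-1)] are small: the Lipschitz property then
    bounds [f x] above by about [mdist (iota x) a], and [mul_eq1_le] bounds it below. *)
Lemma mul_eq1_completion_dist f g : (f * g)%g = 1%g ->
  exists a, f = completion_dist a.
Proof.
move=> fg1; have [a approx] := mul_eq1_cvg fg1; exists a.
apply: lip1pP => x; apply/eqP; rewrite -subr_eq0 -normr_le0.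
apply/ler_addgt0Pr => e e0.
have [|y ya fgy] := approx (e / 2); first by rewrite divr_gt0.
have := lip1p_le f x y; have := mul_eq1_le x y fg1.
have := lip1p_ge0 f y; have := lip1p_ge0 g (y^-1)%g.
have := metric_triangle (iota x) (iota y) a.
have := metric_triangle (iota x) a (iota y).
rewrite (metric_sym a) !(completion_isometry iotaP) ler_norml /=; lra.
Qed.

Lemma isoAut_restrict (Phi : isoAut (lip1p X)) :
  exists T : isoAut Xbar,
    forall a, Phi (completion_dist a) = completion_dist (T a).
Proof.
have act (Psi : isoAut (lip1p X)) : exists T : Xbar -> Xbar,
    forall a, Psi (completion_dist a) = completion_dist (T a).
  suff /choice[T PsiT] a : exists b, Psi (completion_dist a) = completion_dist b.
    by exists T.
  apply: (@mul_eq1_completion_dist _ (Psi (completion_dist a^-1%g))).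
  rewrite -(isoAut_morph Psi) -completion_distM mulgV completion_dist1.
  by rewrite (isoAut_morph Psi).
(* Stated for any automorphism so that using it for [Phi] and its inverse makes [T] an isometry. *)
have act_le (Psi : isoAut (lip1p X)) (S : Xbar -> Xbar) a b :
    (forall c, Psi (completion_dist c) = completion_dist (S c)) ->
    mdist (S a) (S b) <= mdist a b.
  move=> PsiS; apply/completion_dist_near; rewrite -!PsiS.
  by apply: isoAut_near; rewrite ?mdist_ge0//; exact/completion_dist_near.
have [T PhiT] := act Phi; have [S PhiS] := act (Phi^-1)%g.
have TK : cancel T S.
  by move=> a; apply: completion_dist_inj; rewrite -PhiS -PhiT isoAutK.
have SK : cancel S T.
  by move=> a; apply: completion_dist_inj; rewrite -PhiT -PhiS isoAutVK.
have TM : {morph T : a b / (a * b)%g}.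
  move=> a b; apply: completion_dist_inj.
  by rewrite completion_distM -!PhiT completion_distM (isoAut_morph Phi).
have T1 : T 1%g = 1%g by apply: (mulgI (T 1%g)); rewrite -TM !mulg1.
have Tisom a b : mdist (T a) (T b) = mdist a b.
  apply/le_anti; rewrite (act_le _ _ _ _ PhiT).
  by rewrite -{1}(TK a) -{1}(TK b) (act_le _ _ _ _ PhiS).
by exists (IsoAut (Bijective TK SK) (T1, TM) Tisom).
Qed.

(** * Extending automorphisms of [Xbar] to the monoid *)

Section Transport.
Implicit Types S T : isoAut Xbar.

(* The McShane extension of [f] to [Xbar], precomposed with the inverse of [T]
   and restricted to [X]. *)
Definition transport T f x : R :=
  inf (range (fun y => f y + mdist (T (iota y)) (iota x))).

Lemma transport_le T f x y : transport T f x <= f y + mdist (T (iota y)) (iota x).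
Proof.
apply: ge_inf; last by exists y.
by exists 0 => _ [z _ <-]; rewrite addr_ge0 ?lip1p_ge0 ?mdist_ge0.
Qed.

Lemma transport_ge T f x r :
  (forall y, r <= f y + mdist (T (iota y)) (iota x)) -> r <= transport T f x.
Proof.
move=> ge_r; apply: lb_le_inf => [|_ [y _ <-]//].
by exists (f x + mdist (T (iota x)) (iota x)), x.
Qed.

Lemma transport_ge0 T f x : 0 <= transport T f x.
Proof. by apply: transport_ge => y; rewrite addr_ge0 ?lip1p_ge0 ?mdist_ge0. Qed.

Lemma transport_lip T f x y :
  `|transport T f x - transport T f y| <= mdist x y.
Proof.
suff le_d u v : transport T f u <= transport T f v + mdist u v.
  by have := le_d x y; have := le_d y x; rewrite (metric_sym y x) ler_norml; lra.
rewrite -lerBlDr; apply: transport_ge => z; have := transport_le T f u z.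
have := metric_triangle (T (iota z)) (iota v) (iota u).
rewrite (completion_isometry iotaP) (metric_sym v); lra.
Qed.

Definition lift_fun T f : lip1p X :=
  Lip1p (transport_ge0 T f) (transport_lip T f).

Lemma lift_fun_dist T a : lift_fun T (completion_dist a) = completion_dist (T a).
Proof.
apply: lip1pP => x; apply/le_anti/andP; split.
  apply/ler_addgt0Pr => e e0.
  have [|y ya] := @completion_approx a (e / 2); first by rewrite divr_gt0.
  have := transport_le T (completion_dist a) x y.
  have := metric_triangle (T (iota y)) (T a) (iota x).
  rewrite isoAut_isom (metric_sym (T a)) /=; lra.
apply: transport_ge => y /=; rewrite -(isoAut_isom T (iota y)).
have := metric_triangle (iota x) (T (iota y)) (T a).
rewrite (metric_sym (iota x) (T (iota y))); lra.
Qed.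

Lemma lift_fun1 f : lift_fun 1%g f = f.
Proof.
apply: lip1pP => x; apply/le_anti/andP; split.
  by have := transport_le 1%g f x x; rewrite mdistxx addr0.
apply: transport_ge => y.
by rewrite metric_sym (completion_isometry iotaP) lip1p_le.
Qed.

(** One inequality is the triangle inequality through [S (iota y)]. For the other, the best
    intermediate point [T (iota z)] may lie outside [X] and is approximated. *)
Lemma lift_fun_comp S T f : lift_fun (S * T)%g f = lift_fun S (lift_fun T f).
Proof.
apply: lip1pP => x; apply/le_anti/andP; split.
  apply: transport_ge => y; rewrite -lerBlDr; apply: transport_ge => z.
  rewrite lerBlDr; apply: le_trans (transport_le (S * T)%g f x z) _.
  rewrite -addrA lerD2l isoAut_mulE -[X in _ <= X + _](isoAut_isom S).
  exact: metric_triangle.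
apply: transport_ge => z; apply/ler_addgt0Pr => e e0.
have [|y yz] := @completion_approx (T (iota z)) (e / 2); first by rewrite divr_gt0.
have := transport_le S (lift_fun T f) x y; have := transport_le T f y z.
have := metric_triangle (S (iota y)) (S (T (iota z))) (iota x).
rewrite isoAut_isom isoAut_mulE (metric_sym (T _)) /=; lra.
Qed.

Lemma lift_funM T f g : lift_fun T (f * g)%g = (lift_fun T f * lift_fun T g)%g.
Proof.
apply: lip1pP => x; apply/le_anti/andP; split.
  apply: inf_conv_ge => u v <-; rewrite -lerBlDr; apply: transport_ge => y.
  rewrite lerBlDr addrC -lerBlDr; apply: transport_ge => z.
  rewrite lerBlDr addrC.
  have := transport_le T (f * g)%g (u * v)%g (y * z)%g.
  have := inf_conv_le f g y z.
  rewrite !(completion_extends iotaP) (isoAut_morph T) lip1p_mulE /=.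
  have := metric_triangle (T (iota y) * T (iota z))%g (iota u * T (iota z))%g
    (iota u * iota v)%g.
  rewrite completion_mul2l completion_mul2r; lra.
apply: transport_ge => w; rewrite -lerBlDr; apply: inf_conv_ge => y z yzw.
rewrite lerBlDr; apply/ler_addgt0Pr => e e0.
(* A splitting [w = y * z] is carried to the splitting of [x] into [u] and [u^-1 * x], with [u]
   close to [T (iota y)]. *)
have [|u uy] := @completion_approx (T (iota y)) (e / 2); first by rewrite divr_gt0.
have := inf_conv_le (lift_fun T f) (lift_fun T g) u (u^-1 * x)%g.
have := transport_le T f u y; have := transport_le T g (u^-1 * x)%g z.
rewrite mulVKg lip1p_mulE /= -yzw (completion_extends iotaP) (isoAut_morph T).
rewrite -[mdist (T (iota z)) _](completion_mul2l (iota u)).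
rewrite -(completion_extends iotaP) mulVKg.
have := metric_triangle (iota u * T (iota z))%g (T (iota y) * T (iota z))%g (iota x).
rewrite completion_mul2r (metric_sym (T (iota y)) (iota u)); lra.
Qed.

Lemma lift_fun_le T f g r : (forall x, `|f x - g x| <= r) ->
  forall x, `|lift_fun T f x - lift_fun T g x| <= r.
Proof.
suff le_r (h k : lip1p X) : (forall x, `|h x - k x| <= r) ->
    forall x, lift_fun T h x <= lift_fun T k x + r.
  move=> fg x; have gf y : `|g y - f y| <= r by rewrite distrC.
  by have := le_r f g fg x; have := le_r g f gf x; rewrite ler_norml; lra.
move=> hk x; rewrite -lerBlDr; apply: transport_ge => y.
have := transport_le T h x y; have := hk y; rewrite ler_norml /=; lra.
Qed.

Lemma lift_fun_mdist_le T f g : mdist (lift_fun T f) (lift_fun T g) <= mdist f g.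
Proof. by apply: mdist_lip1p_le => r _; exact: lift_fun_le. Qed.

Lemma isoAut_extend T : exists Phi : isoAut (lip1p X),
  forall a, Phi (completion_dist a) = completion_dist (T a).
Proof.
have liftK S : cancel (lift_fun S) (lift_fun (S^-1)%g).
  by move=> f; rewrite -lift_fun_comp mulVg lift_fun1.
have liftVK S : cancel (lift_fun (S^-1)%g) (lift_fun S).
  by move=> f; rewrite -lift_fun_comp mulgV lift_fun1.
have lift1 : lift_fun T 1%g = 1%g.
  by rewrite -completion_dist1 lift_fun_dist (isoAut_morph T).
have lift_isom f g : mdist (lift_fun T f) (lift_fun T g) = mdist f g.
  apply/le_anti; rewrite lift_fun_mdist_le.
  by rewrite -{1}(liftK T f) -{1}(liftK T g) lift_fun_mdist_le.
exists (IsoAut (Bijective (liftK T) (liftVK T)) (lift1, lift_funM T) lift_isom).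
exact: lift_fun_dist.
Qed.

End Transport.
End Completion.

Theorem corollary1 (R : realType) (X : invMetricGroupType R)
    (Xbar : completeMetricGroupType R) (iota : X -> Xbar) :
  is_group_completion iota ->
  group_isomorphic (isoAut (lip1p X)) (isoAut Xbar).
Proof.
move=> iotaP; have [phi phiE] := choice (isoAut_restrict iotaP).
have [psi psiE] := choice (isoAut_extend iotaP).
(* The action on distance functions determines [T]; multiplicativity of [phi] and [phi (psi T) = T]
   both follow. *)
have phi_uniq (Phi : isoAut (lip1p X)) (T : isoAut Xbar) :
    (forall a, Phi (completion_dist iotaP a) = completion_dist iotaP (T a)) ->
    phi Phi = T.
  move=> PhiT; apply: isoAutP => a; apply: (@completion_dist_inj _ _ _ _ iotaP).
  by rewrite -phiE PhiT.
have phiM : {morph phi : Phi Psi / (Phi * Psi)%g}.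
  by move=> Phi Psi; apply: phi_uniq => a; rewrite !isoAut_mulE !phiE.
exists phi => //; exists psi => [Phi|T]; last exact/phi_uniq/psiE.
(* [Phi] and [psi (phi Phi)] act alike on distance functions, so rigidity makes their quotient
   trivial. *)
have fix_dist : fixes_dist ((psi (phi Phi))^-1 * Phi)%g.
  move=> x; rewrite isoAut_mulE -(completion_dist_iota iotaP) phiE -psiE.
  exact: isoAutK.
by rewrite -[LHS]mulg1 -(isoAut_rigid fix_dist) mulVKg.
Qed.
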